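(* Let $(E,d)$ be a complete CAT$(0)$ space, $X\in P_{b,cl,cv}(E)$ and $Y\in P_{b,cl}(E)$. The problem $\min(X,Y)$ is well-posed if and only if \[\inf_{\sigma>0}\mathrm{diam}\,L_{YX}(\sigma)=0.\]
   Context: $P_{b,cl}(E)$ is the family of nonempty, bounded, closed subsets of $E$; $P_{b,cl,cv}(E)$ is the family of nonempty, bounded, closed, convex subsets of $E$, where a set is convex if every geodesic segment joining two of its points is contained in it. For $X,Y\in P_{b,cl}(E)$ and $\sigma>0$ put $\lambda_{XY}=\inf\{d(x,y):x\in X,y\in Y\}$ and $L_{YX}(\sigma)=\{y\in Y:\mathrm{dist}(y,X)\le\lambda_{XY}+\sigma\}$, where $\mathrm{dist}(z,X)=\inf_{x\in X}d(z,x)$. The problem $\min(X,Y)$ consists in finding $(x_0,y_0)\in X\times Y$ (a solution) with $d(x_0,y_0)=\lambda_{XY}$. A minimizing sequence is a sequence $(x_n,y_n)$ in $X\times Y$ with $d(x_n,y_n)\to\lambda_{XY}$. The problem $\min(X,Y)$ is well-posed if it has a unique solution $(x_0,y_0)$ and every minimizing sequence $(x_n,y_n)$ satisfies $x_n\to x_0$ and $y_n\to y_0$. *)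

(* Defs.v *)
From HB Require Import structures.
From mathcomp Require Import all_boot all_order all_algebra.
From mathcomp Require Import all_classical all_reals all_analysis.

Set Implicit Arguments.
Unset Strict Implicit.
Unset Printing Implicit Defensive.

Import Order.TTheory GRing.Theory Num.Theory.
Import numFieldNormedType.Exports.

Local Open Scope classical_set_scope.
Local Open Scope ring_scope.

#[short(type="completeMetricType")]
HB.structure Definition CompleteMetric (R : numDomainType) :=
  {M of Metric R M & Complete M}.

Section EuclideanPlane.
Context {R : realType}.

(* The library metric on a product is the sup metric, hence this definition. *)
Definition plane_dist (p q : R * R) : R :=
  Num.sqrt ((p.1 - q.1) ^+ 2 + (p.2 - q.2) ^+ 2).

Definition plane_segment (a b : R * R) : set (R * R) :=
  [set ((1 - t) * a.1 + t * b.1, (1 - t) * a.2 + t * b.2) | t in `[0, 1]].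

End EuclideanPlane.

Section Geodesics.
Context {R : realType} {E : metricType R}.
Implicit Types (x y : E) (S X : set E).

(* Only the restriction of c to [0, l] is relevant. *)
Definition geodesic_path (c : R -> E) (l : R) x y : Prop :=
  [/\ 0 <= l, c 0 = x, c l = y &
      forall s t : R, 0 <= s <= l -> 0 <= t <= l -> mdist (c s) (c t) = `|s - t|].

Definition geodesic_segment x y S : Prop :=
  exists (c : R -> E) (l : R), geodesic_path c l x y /\ S = c @` `[0, l].

Definition geodesically_convex X : Prop :=
  forall x y S, X x -> X y -> geodesic_segment x y S -> S `<=` X.

Definition comparison_triangle (x1 x2 x3 : E) (a1 a2 a3 : R * R) : Prop :=
  [/\ plane_dist a1 a2 = mdist x1 x2,
      plane_dist a2 a3 = mdist x2 x3 &
      plane_dist a3 a1 = mdist x3 x1].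

(* a is a comparison point in [a1, a2] of the point p of the side S, where S
   joins x1 to x2. *)
Definition side_comparison_point x1 S (a1 a2 : R * R) (p : E) (a : R * R) :=
  [/\ S p, plane_segment a1 a2 a & plane_dist a1 a = mdist x1 p].

Definition comparison_point (x1 x2 x3 : E) (S12 S23 S31 : set E)
    (a1 a2 a3 : R * R) (p : E) (a : R * R) : Prop :=
  [\/ side_comparison_point x1 S12 a1 a2 p a,
      side_comparison_point x2 S23 a2 a3 p a |
      side_comparison_point x3 S31 a3 a1 p a].

End Geodesics.

Definition geodesic_space {R : realType} (E : metricType R) : Prop :=
  forall x y : E, exists S, geodesic_segment x y S.

Definition CAT0 {R : realType} (E : metricType R) : Prop :=
  geodesic_space E /\
  forall (x1 x2 x3 : E) (S12 S23 S31 : set E) (a1 a2 a3 : R * R),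
    geodesic_segment x1 x2 S12 ->
    geodesic_segment x2 x3 S23 ->
    geodesic_segment x3 x1 S31 ->
    comparison_triangle x1 x2 x3 a1 a2 a3 ->
    forall (p q : E) (a b : R * R),
      comparison_point x1 x2 x3 S12 S23 S31 a1 a2 a3 p a ->
      comparison_point x1 x2 x3 S12 S23 S31 a1 a2 a3 q b ->
      mdist p q <= plane_dist a b.

Section MinProblem.
Context {R : realType} {E : metricType R}.
Implicit Types (X Y A : set E).

Definition metric_bounded A : Prop :=
  exists M : R, forall x y, A x -> A y -> mdist x y <= M.

Definition P_b_cl : set (set E) :=
  [set A | [/\ A !=set0, metric_bounded A & closed A]].

Definition P_b_cl_cv : set (set E) :=
  P_b_cl `&` [set A | geodesically_convex A].

Definition dist_to (z : E) X : R := inf [set mdist z x | x in X].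

Definition lambda X Y : R := inf [set mdist x y | x in X & y in Y].

Definition diam A : R := sup [set mdist x y | x in A & y in A].

(* L Y X sigma is $L_{YX}(\sigma)$, a subset of Y. *)
Definition L Y X (sigma : R) : set E :=
  [set y | Y y /\ dist_to y X <= lambda X Y + sigma].

Definition min_solution X Y (x0 y0 : E) : Prop :=
  [/\ X x0, Y y0 & mdist x0 y0 = lambda X Y].

Definition minimizing_sequence X Y (x y : nat -> E) : Prop :=
  (forall n, X (x n) /\ Y (y n)) /\
  mdist (x n) (y n) @[n --> \oo] --> lambda X Y.

Definition well_posed X Y : Prop :=
  exists x0 y0 : E,
    [/\ min_solution X Y x0 y0,
        forall x y, min_solution X Y x y -> x = x0 /\ y = y0 &
        forall x y, minimizing_sequence X Y x y ->
          x @ \oo --> x0 /\ y @ \oo --> y0].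

End MinProblem.

(* Main.v *)
Require Import Defs.
From HB Require Import structures.
From mathcomp Require Import all_boot all_order all_algebra.
From mathcomp Require Import all_classical all_reals all_analysis.
From mathcomp Require Import ring lra.

Import Order.TTheory GRing.Theory Num.Theory.
Import numFieldNormedType.Exports.

Local Open Scope classical_set_scope.
Local Open Scope ring_scope.

(** Well-posedness amounts to near-minimizing pairs being uniformly close to each
    other. If [diam L_YX(sigma)] is small, the second components [y], [y'] of
    two near-minimizing pairs [(x, y)], [(x', y')] are close, so [x] and [x']
    both nearly realize the distance from [y] to the convex set [X]. Applying
    the CN inequality at [y] to the midpoint of a segment from [x] to [x'],
    which lies in [X] and hence at distance at least [lambda] from [y], bounds
    [d(x, x')]. The converse holds in any metric space. *)

(** Place a side of length [l] from the origin to [(l, 0)]. The law of cosines gives the abscissa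
    [u] of the apex, and the triangle inequalities give [u ^+ 2 <= b ^+ 2], so an ordinate
    exists. *)
Lemma comparison_apex (R : realType) (l b c : R) :
  0 < l -> 0 <= b -> 0 <= c -> l <= b + c -> b <= l + c -> c <= l + b ->
  exists u v : R, u ^+ 2 + v ^+ 2 = b ^+ 2 /\
                  (u - l) ^+ 2 + v ^+ 2 = c ^+ 2.
Proof.
move=> l0 b0 c0 lbc blc clb.
pose u := (b ^+ 2 + l ^+ 2 - c ^+ 2) / (2 * l).
have ul : 2 * l * u = b ^+ 2 + l ^+ 2 - c ^+ 2 by rewrite /u; field; lra.
have u2 : u ^+ 2 <= b ^+ 2.
  (* Multiplied by [2 * l], the two bounds on [u] become [(b - l) ^+ 2 <= c ^+ 2] and
     [c ^+ 2 <= (b + l) ^+ 2]. *)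
  have ub : u <= b by rewrite -(ler_pM2l (x := 2 * l)) ?ul; nra.
  have bu : - b <= u by rewrite -(ler_pM2l (x := 2 * l)) ?ul; nra.
  by rewrite -subr_ge0 subr_sqr mulr_ge0//; lra.
exists u, (Num.sqrt (b ^+ 2 - u ^+ 2)).
rewrite sqr_sqrtr ?subr_ge0//; split; first by ring.
by rewrite sqrrB; nra.
Qed.

(** * The CN inequality of Bruhat and Tits *)

Section CNInequality.
Context {R : realType} {E : metricType R}.

(** In the plane the squared length of a median equals the right-hand side (Apollonius), and the
    CAT(0) condition bounds [mdist z m] by that length. The point [m] is the midpoint of [S], the
    same for all [z]. *)
Lemma CAT0_CN_inequality (x y : E) (S : set E) :
  CAT0 E -> geodesic_segment x y S ->
  exists2 m, S m & forall z, mdist z m ^+ 2 <=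
    (mdist z x ^+ 2 + mdist z y ^+ 2) / 2 - mdist x y ^+ 2 / 4.
Proof.
move=> [geo cat] Sxy; have [c [l [[l0 c0 cl cE] SE]]] := Sxy.
have dxy : mdist x y = l.
  by rewrite -c0 -cl cE ?lexx ?l0// sub0r normrN ger0_norm.
have l2 : 0 <= l / 2 <= l by apply/andP; split; lra.
exists (c (l / 2)); first by rewrite SE; exists (l / 2) => //=; rewrite in_itv.
(* A degenerate side has no direction along which to place the planar triangle, but then
   [x = m = y]. *)
move=> z; have [l00|lN0] := eqVneq l 0.
  have xy : x = y by apply: mdist_positivity; rewrite dxy.
  by rewrite l00 mul0r c0 xy mdistxx; lra.
have lgt0 : 0 < l by rewrite lt_neqAle eq_sym lN0.
have [u [v [uv1 uv2]]] : exists u v : R, u ^+ 2 + v ^+ 2 = mdist z x ^+ 2 /\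
    (u - l) ^+ 2 + v ^+ 2 = mdist z y ^+ 2.
  apply: comparison_apex; rewrite ?mdist_ge0// -dxy.
  - by rewrite (metric_sym z x) metric_triangle.
  - by rewrite (metric_sym z y) (metric_sym z x) metric_triangle.
  - by rewrite addrC metric_triangle.
have [Szx hzx] := geo z x; have [Syz hyz] := geo y z.
have dm : mdist x (c (l / 2)) = l / 2.
  rewrite -{1}c0 cE ?lexx ?l0// sub0r normrN ger0_norm//.
  by case/andP: l2.
have sq (a : R) : 0 <= a -> Num.sqrt (a ^+ 2) = a.
  by move=> a0; rewrite sqrtr_sqr ger0_norm.
have tri : comparison_triangle z x y (u, v) (0, 0) (l, 0).
  rewrite /comparison_triangle /plane_dist /=; split.
  - by rewrite !subr0 uv1 sq// mdist_ge0.
  - by rewrite sub0r subrr sqrrN expr0n addr0 sq// dxy.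
  - by rewrite sub0r sqrrN -opprB sqrrN uv2 sq ?mdist_ge0// metric_sym.
have zS : Szx z.
  have [g [k [[k0 g0 _ _] ->]]] := hzx.
  by exists 0 => //=; rewrite in_itv/= lexx.
have pz : comparison_point z x y Szx S Syz (u, v) (0, 0) (l, 0) z (u, v).
  apply: Or31; split => //=.
    by exists 0; rewrite /= ?in_itv/= ?lexx ?ler01// subr0 !mul1r !mul0r !addr0.
  by rewrite /plane_dist /= !subrr expr0n addr0 sqrtr0 mdistxx.
have pm : comparison_point z x y Szx S Syz (u, v) (0, 0) (l, 0)
    (c (l / 2)) (l / 2, 0).
  apply: Or32; split => //=.
  - by rewrite SE; exists (l / 2) => //=; rewrite in_itv.
  - exists (2^-1); first by rewrite /= in_itv/=; apply/andP; split; lra.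
    by rewrite /= !mulr0 !add0r mulrC.
  - rewrite /plane_dist /= dm sub0r subrr sqrrN expr0n addr0 sq//.
    by case/andP: l2.
have := cat _ _ _ _ _ _ _ _ _ hzx Sxy hyz tri _ _ _ _ pz pm.
have -> : plane_dist (u, v) (l / 2, 0) =
    Num.sqrt ((mdist z x ^+ 2 + mdist z y ^+ 2) / 2 - mdist x y ^+ 2 / 4).
  rewrite /plane_dist /=; congr Num.sqrt.
  by rewrite -uv1 -uv2 dxy; field.
set w := (X in Num.sqrt X).
(* Squaring [Num.sqrt w] gives back [w] only for [0 <= w]; here [w] is a squared planar distance. *)
move=> h; have w0 : 0 <= w.
  rewrite /w -uv1 -uv2 dxy.
  have -> : (u ^+ 2 + v ^+ 2 + ((u - l) ^+ 2 + v ^+ 2)) / 2 - l ^+ 2 / 4 =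
    (u - l / 2) ^+ 2 + v ^+ 2 by field.
  by rewrite addr_ge0 ?sqr_ge0.
by rewrite -/w -(sqr_sqrtr w0) ler_pXn2r ?nnegrE ?mdist_ge0 ?sqrtr_ge0.
Qed.

End CNInequality.

(** * Near-minimizing pairs and the sets [L Y X s] *)

Section MinProblemLemmas.
Context {R : realType} {E : metricType R}.
Implicit Types (X Y A : set E).

Lemma lambda_lbound X Y : lbound [set mdist x y | x in X & y in Y] 0.
Proof. by move=> _ [x Xx [y Yy <-]]; exact: mdist_ge0. Qed.

Lemma lambda_ge0 X Y : X !=set0 -> Y !=set0 -> 0 <= lambda X Y.
Proof.
move=> [x Xx] [y Yy]; apply: lb_le_inf (lambda_lbound X Y).
by exists (mdist x y); exists x => //; exists y.
Qed.

Lemma lambda_le X Y x y : X x -> Y y -> lambda X Y <= mdist x y.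
Proof.
move=> Xx Yy; apply: ge_inf; first by exists 0; exact: lambda_lbound.
by exists x => //; exists y.
Qed.

Lemma lambda_approx X Y (e : R) : X !=set0 -> Y !=set0 -> 0 < e ->
  exists x y, [/\ X x, Y y & mdist x y <= lambda X Y + e].
Proof.
move=> [x Xx] [y Yy] e0.
have [||r [x' Xx' [y' Yy' <-]] /ltW h] :=
  @inf_lt R [set mdist x y | x in X & y in Y] (lambda X Y + e).
- by exists (mdist x y); exists x => //; exists y.
- by rewrite ltrDl.
by exists x', y'.
Qed.

(** Together with [near_minimizing_of_L], this identifies the points of [L Y X s] with second
    components of near-minimizing pairs, up to an arbitrarily small slack. *)
Lemma L_of_near_minimizing X Y (s : R) x y :
  X x -> Y y -> mdist x y <= lambda X Y + s -> L Y X s y.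
Proof.
move=> Xx Yy h; split=> //; apply: le_trans h.
rewrite metric_sym; apply: ge_inf; last by exists x.
by exists 0 => _ [z _ <-]; exact: mdist_ge0.
Qed.

(** The slack [e] is there because the infimum [dist_to y X] may not be attained. *)
Lemma near_minimizing_of_L X Y (s e : R) y : X !=set0 -> 0 < e ->
  L Y X s y -> exists2 x, X x & mdist x y <= lambda X Y + s + e.
Proof.
move=> [x0 Xx0] e0 [Yy h].
have [||r [x Xx <-] lt] := @inf_lt R [set mdist y x | x in X] (dist_to y X + e).
- by exists (mdist y x0); exists x0.
- by rewrite ltrDl.
by exists x => //; rewrite metric_sym; rewrite /dist_to in lt h *; lra.
Qed.

Lemma L_nonempty X Y (s : R) :
  X !=set0 -> Y !=set0 -> 0 < s -> L Y X s !=set0.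
Proof.
move=> X0 Y0 s0; have [x [y [Xx Yy h]]] := lambda_approx X Y s X0 Y0 s0.
by exists y; exact: L_of_near_minimizing h.
Qed.

Lemma le_diam A x y : metric_bounded A -> A x -> A y -> mdist x y <= diam A.
Proof.
move=> [M hM] Ax Ay; apply: ub_le_sup; last by exists x => //; exists y.
by exists M => _ [a Aa [b Ab <-]]; exact: hM.
Qed.

Lemma diam_le A (M : R) : A !=set0 ->
  (forall x y, A x -> A y -> mdist x y <= M) -> diam A <= M.
Proof.
move=> [a Aa] h; apply: ge_sup.
  by exists (mdist a a); exists a => //; exists a.
by move=> _ [x Ax [y Ay <-]]; exact: h.
Qed.

Lemma L_bounded X Y (s : R) : metric_bounded Y -> metric_bounded (L Y X s).
Proof. by move=> [M hM]; exists M => x y [Yx _] [Yy _]; exact: hM. Qed.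

Lemma diam_L_lbound X Y : X !=set0 -> Y !=set0 -> metric_bounded Y ->
  lbound [set diam (L Y X s) | s in [set s : R | 0 < s]] 0.
Proof.
move=> X0 Y0 bY _ [s /= s0 <-]; have [y Ly] := L_nonempty X Y s X0 Y0 s0.
by rewrite -(mdistxx y) le_diam//; exact: L_bounded.
Qed.

(** A uniform Cauchy condition without sequences or limits, through which the diameter condition
    yields well-posedness. *)
Definition near_minimizers_close X Y : Prop :=
  forall e : R, 0 < e -> exists2 d : R, 0 < d &
    forall x x' y y', X x -> X x' -> Y y -> Y y' ->
      mdist x y <= lambda X Y + d -> mdist x' y' <= lambda X Y + d ->
      mdist x x' <= e /\ mdist y y' <= e.

(** The midpoint [m] of [x] and [x'] lies in [X], so the CN inequality at [y] gives [lambda ^+ 2 <=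
    mdist y m ^+ 2 <= (lambda + t) ^+ 2 - mdist x x' ^+ 2 / 4]. *)
Lemma near_projections_close X Y (t : R) x x' y :
  CAT0 E -> geodesically_convex X -> 0 <= lambda X Y ->
  X x -> X x' -> Y y ->
  mdist x y <= lambda X Y + t -> mdist x' y <= lambda X Y + t ->
  mdist x x' ^+ 2 <= 4 * (2 * lambda X Y * t + t ^+ 2).
Proof.
move=> cat cvX l0 Xx Xx' Yy h h'.
have [S Sxx'] := cat.1 x x'.
have [m Sm /(_ y)] := CAT0_CN_inequality x x' S cat Sxx'.
have := lambda_le X Y m y (cvX _ _ _ Xx Xx' Sxx' _ Sm) Yy.
rewrite (metric_sym m) (metric_sym y x) (metric_sym y x').
have := mdist_ge0 x y; have := mdist_ge0 x' y.
move: (mdist x x') (mdist y m) (mdist x y) (mdist x' y) (lambda X Y) l0 h h'.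
move=> D m' a b l l0 al bl b0 a0 lm cn.
have : a ^+ 2 <= (l + t) ^+ 2 by rewrite ler_pXn2r ?nnegrE//; lra.
have : b ^+ 2 <= (l + t) ^+ 2 by rewrite ler_pXn2r ?nnegrE//; lra.
have : l ^+ 2 <= m' ^+ 2 by rewrite ler_pXn2r ?nnegrE//; lra.
by rewrite sqrrD; lra.
Qed.

Lemma near_minimizers_close_of_diam X Y :
  CAT0 E -> P_b_cl_cv X -> P_b_cl Y ->
  inf [set diam (L Y X s) | s in [set s : R | 0 < s]] = 0 ->
  near_minimizers_close X Y.
Proof.
move=> cat [[X0 _ _] cvX] [Y0 bY _] inf0 e e0.
have l0 := lambda_ge0 X Y X0 Y0; set l := lambda X Y in l0 *.
(* The bound [1] gives [t ^+ 2 <= t], hence [4 * (2 * l * t + t ^+ 2) <= 4 * (2 * l + 1) * t], which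
   the last bound keeps below [e ^+ 2]. *)
pose t := Num.min (Num.min e 1) (e ^+ 2 / (4 * (2 * l + 1))).
have den0 : 0 < 4 * (2 * l + 1) by lra.
have t0 : 0 < t by rewrite !lt_min e0 ltr01 divr_gt0// exprn_gt0.
have te : t <= e by rewrite !ge_min lexx.
have t1 : t <= 1 by rewrite !ge_min lexx orbT.
have te2 : 4 * (2 * l * t + t ^+ 2) <= e ^+ 2.
  have : t <= e ^+ 2 / (4 * (2 * l + 1)) by rewrite !ge_min lexx !orbT.
  rewrite ler_pdivlMr// => h; apply: le_trans h.
  have : t ^+ 2 <= t by rewrite expr2 ger_pMl.
  by lra.
have [||_ [s /= s0 <-] ds] :=
  @inf_lt R [set diam (L Y X s) | s in [set s : R | 0 < s]] (t / 2).
- by exists (diam (L Y X 1)); exists 1 => //=.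
- by rewrite inf0 divr_gt0.
(* The bound [s] puts [y] and [y'] in [L Y X s], within [t / 2] of each other. Passing from [y'] to
   [y] then costs [t / 2], so [mdist x' y <= l + t]. *)
exists (Num.min s (t / 2)); first by rewrite lt_min s0 divr_gt0.
move=> x x' y y' Xx Xx' Yy Yy' h h'.
have mins : Num.min s (t / 2) <= s by rewrite ge_min lexx.
have mint : Num.min s (t / 2) <= t / 2 by rewrite ge_min lexx orbT.
have yy' : mdist y y' <= t / 2.
  apply: le_trans (ltW ds); apply: le_diam; first exact: L_bounded.
    by apply: (L_of_near_minimizing X Y s x) => //; rewrite -/l; lra.
  by apply: (L_of_near_minimizing X Y s x') => //; rewrite -/l; lra.
split; last by lra.
rewrite -(ler_pXn2r (n := 2)) ?nnegrE ?mdist_ge0 ?(ltW e0)//.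
apply: le_trans te2; apply: (near_projections_close X Y t x x' y) => //.
  by rewrite -/l; lra.
have := metric_triangle x' y' y; rewrite (metric_sym y' y) -/l.
by lra.
Qed.

End MinProblemLemmas.

Import metricType_numDomainType.

(** * Well-posedness and near-minimizing pairs *)

Section WellPosed.
Context {R : realType}.

Lemma cauchy_seq_cvg {E : completeMetricType R} (u : nat -> E) :
  (forall e : R, 0 < e -> exists N, forall n m, (N <= n)%N -> (N <= m)%N ->
     mdist (u n) (u m) <= e) ->
  exists l : E, u @ \oo --> l.
Proof.
move=> h; apply/cvg_ex; apply: cauchy_cvg; apply: cauchy_exP => e e0.
(* Halving [e] turns the large inequality into the strict one that defines the ball. *)
have [N hN] := h (e / 2) ltac:(by rewrite divr_gt0).
exists (u N); exists N => // n /= Nn; rewrite ballEmdist /=.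
by apply: le_lt_trans (hN _ _ (leqnn N) Nn) _; lra.
Qed.

(** Closeness makes a minimizing sequence Cauchy, and its limit in [X] and [Y] is a solution.
    Comparing any near-minimizing pair with this solution gives both uniqueness and convergence. *)
Lemma well_posed_of_near_minimizers_close {E : completeMetricType R}
    (X Y : set E) :
  X !=set0 -> Y !=set0 -> closed X -> closed Y ->
  near_minimizers_close X Y -> well_posed X Y.
Proof.
move=> X0 Y0 cX cY close.
have /choice[f Pf] (n : nat) : exists p : E * E,
    [/\ X p.1, Y p.2 & mdist p.1 p.2 <= lambda X Y + n.+1%:R^-1].
  have [x [y h]] := lambda_approx X Y n.+1%:R^-1 X0 Y0 ltac:(by []).
  by exists (x, y).
have small (d : R) : 0 < d -> exists N, forall n, (N <= n)%N ->
    mdist (f n).1 (f n).2 <= lambda X Y + d.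
  move=> d0; have [N _ hN] := near_infty_natSinv_lt (PosNum d0).
  exists N => n /hN /= /ltW h; have [_ _ h'] := Pf n.
  by apply: le_trans h' _; rewrite lerD2l.
have cau (e : R) : 0 < e -> exists N, forall n m, (N <= n)%N -> (N <= m)%N ->
    mdist (f n).1 (f m).1 <= e /\ mdist (f n).2 (f m).2 <= e.
  move=> /close[d /small[N hN] hd]; exists N => n m Nn Nm.
  have [? ? _] := Pf n; have [? ? _] := Pf m.
  by apply: hd => //; exact: hN.
have [x0 fx] := cauchy_seq_cvg (fun n => (f n).1) ltac:(move=> e /cau[N hN];
  by exists N => n m Nn Nm; have [] := hN _ _ Nn Nm).
have [y0 fy] := cauchy_seq_cvg (fun n => (f n).2) ltac:(move=> e /cau[N hN];
  by exists N => n m Nn Nm; have [] := hN _ _ Nn Nm).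
have Xx0 : X x0.
  by apply: (closed_cvg _ cX _ _ fx); near=> n; have [] := Pf n.
have Yy0 : Y y0.
  by apply: (closed_cvg _ cY _ _ fy); near=> n; have [] := Pf n.
have sol : mdist x0 y0 = lambda X Y.
  apply/eqP; rewrite eq_le lambda_le// andbT.
  apply/ler_addgt0Pr => e e0; have e3 : 0 < e / 3 by rewrite divr_gt0.
  have [N hN] := small _ e3.
  near \oo => n.
  have h1 : mdist x0 (f n).1 <= e / 3.
    by near: n; exact: (cvgr_dist_le fx).
  have h2 : mdist y0 (f n).2 <= e / 3.
    by near: n; exact: (cvgr_dist_le fy).
  have h3 : mdist (f n).1 (f n).2 <= lambda X Y + e / 3.
    by apply: hN; near: n; exact: nbhs_infty_ge.
  have := metric_triangle x0 (f n).1 y0.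
  have := metric_triangle (f n).1 (f n).2 y0.
  by rewrite (metric_sym (f n).2 y0); lra.
(* The solution is near-minimizing for every [d], so it can be one of the two pairs in [close]. *)
have near_sol (e : R) : 0 < e -> exists2 d : R, 0 < d & forall x y,
    X x -> Y y -> mdist x y <= lambda X Y + d ->
    mdist x0 x <= e /\ mdist y0 y <= e.
  move=> /close[d d0 hd]; exists d => // x y Xx Yy h.
  by apply: hd => //; rewrite sol; lra.
exists x0, y0; split => //.
- move=> x y [Xx Yy xy].
  have eq0 (a b : E) : (forall e : R, 0 < e -> mdist b a <= e) -> a = b.
    move=> h; apply: mdist_positivity; rewrite metric_sym.
    by apply/eqP; rewrite eq_le mdist_ge0 andbT; apply/ler_addgt0Pr => e /h;
       rewrite add0r.
  split; apply: eq0 => e /near_sol[d d0 hd];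
    by have [] := hd x y Xx Yy ltac:(rewrite xy; lra).
- move=> x y [XY xy].
  have ev (e : R) : 0 < e ->
      \forall n \near \oo, mdist x0 (x n) <= e /\ mdist y0 (y n) <= e.
    move=> /near_sol[d d0 hd]; near=> n.
    have [Xx Yy] := XY n; apply: hd => //.
    have : `|mdist (x n) (y n) - lambda X Y| <= d.
      by near: n; exact: cvgr_distC_le.
    by rewrite ler_distl => /andP[].
  split; apply/cvgrPdist_le => e /ev h; by apply: filterS h => n [].
Unshelve. all: by end_near. Qed.

(** Otherwise, for some [e], pairs of slack [1 / (n + 1)] with second component farther than [e]
    from [y0] would form a minimizing sequence, which must converge to the solution. *)
Lemma well_posed_near_solution {E : metricType R} (X Y : set E) :
  well_posed X Y -> exists y0 : E, forall e : R, 0 < e ->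
    exists2 d : R, 0 < d & forall x y, X x -> Y y ->
      mdist x y <= lambda X Y + d -> mdist y0 y <= e.
Proof.
move=> [x0 [y0 [_ _ conv]]]; exists y0 => e e0; apply: contrapT => no.
have /choice[f Pf] (n : nat) : exists p : E * E,
    [/\ X p.1, Y p.2, mdist p.1 p.2 <= lambda X Y + n.+1%:R^-1 &
        e < mdist y0 p.2].
  apply: contrapT => nop; apply: no; exists n.+1%:R^-1 => // x y Xx Yy h.
  by rewrite leNgt; apply/negP => ey; apply: nop; exists (x, y).
have [|_ fy] := conv (fun n => (f n).1) (fun n => (f n).2).
  split=> [n|]; first by have [] := Pf n.
  apply: (@squeeze_cvgr _ _ _ _ (fun=> lambda X Y)
    (fun n => lambda X Y + harmonic n)).
  - near=> n; have [Xx Yy h _] := Pf n; rewrite lambda_le//=.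
  - exact: cvg_cst.
  - by rewrite -[X in _ --> X]addr0; apply: cvgD; [exact: cvg_cst|
      exact: cvg_harmonic].
near \oo => n; have [_ _ _] := Pf n.
rewrite ltNge => /negP; apply; near: n.
exact: (cvgr_dist_le fy).
Unshelve. all: by end_near. Qed.

(** For small [s] the set [L Y X s] lies in the closed ball of radius [e / 2] about [y0], so its
    diameter is at most [e]. *)
Lemma inf_diam_of_well_posed {E : metricType R} (X Y : set E) :
  X !=set0 -> P_b_cl Y -> well_posed X Y ->
  inf [set diam (L Y X s) | s in [set s : R | 0 < s]] = 0.
Proof.
move=> X0 [Y0 bY _] /well_posed_near_solution[y0 near0].
have lb := diam_L_lbound X Y X0 Y0 bY.
apply/eqP; rewrite eq_le; apply/andP; split; last first.
  by apply: lb_le_inf lb; exists (diam (L Y X 1)); exists 1 => //=.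
apply/ler_addgt0Pr => e e0; rewrite add0r.
have [d d0 hd] := near0 (e / 2) ltac:(by rewrite divr_gt0).
(* One half of [d] is the parameter of [L], the other the slack in choosing [x] for a given [y]. *)
have d2 : 0 < d / 2 by rewrite divr_gt0.
apply: (@le_trans _ _ (diam (L Y X (d / 2)))).
  by apply: ge_inf; [exists 0|exists (d / 2)].
apply: diam_le; first exact: L_nonempty.
have close y : L Y X (d / 2) y -> mdist y0 y <= e / 2.
  move=> Ly; have [x Xx h] := near_minimizing_of_L X Y _ _ _ X0 d2 Ly.
  by apply: (hd x) => //; [case: Ly|lra].
move=> y y' /close h /close h'.
by have := metric_triangle y y0 y'; rewrite (metric_sym y y0); lra.
Qed.

End WellPosed.

Theorem proposition3p5 (R : realType) (E : completeMetricType R)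
    (X Y : set E) :
  CAT0 E -> P_b_cl_cv X -> P_b_cl Y ->
  (well_posed X Y <->
   inf [set diam (L Y X sigma) | sigma in [set s : R | 0 < s]] = 0).
Proof.
move=> cat PX PY; have [[X0 _ cX] _] := PX; have [Y0 _ cY] := PY.
split; first exact: inf_diam_of_well_posed.
move=> /(near_minimizers_close_of_diam X Y cat PX PY).
exact: well_posed_of_near_minimizers_close.
Qed.
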